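(* In $N_{\mathbb{R}}=\mathbb{R}^4$ with lattice $N=\mathbb{Z}^4$, let $$\Delta_1 = \mathrm{Conv}\big((1,0,0,0),(0,1,0,0),(0,0,1,0),(0,0,0,1),(-1,-1,-1,-1)\big),$$ $$\Delta_2 = \mathrm{Conv}\big((1,0,0,0),(0,1,0,0),(0,0,1,0),(0,0,0,1),(-1,-1,-1,-1),(1,1,1,1),(0,0,0,-1)\big).$$ Then $\Delta_1\subseteq\Delta_2$ are reflexive polytopes and the toric varieties $X(\Delta_1)$ and $X(\Delta_2)$ are smooth, but the intersection fan of $\Sigma(\Delta_1)$ and $\Sigma(\Delta_2)$ contains the ray over $(1,1,1,0)$, which is a ray of neither $\Sigma(\Delta_1)$ nor $\Sigma(\Delta_2)$, and the lattice point $(1,1,1,0)$ is contained in neither $\Delta_1$ nor $\Delta_2$. Consequently $\Sigma(\Delta_2)$ is not a refinement of $\Sigma(\Delta_1)$, i.e. the identity map of $N$ does not induce a toric morphism $X(\Delta_2)\to X(\Delta_1)$.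
   Context: Let $M = \mathrm{Hom}(N,\mathbb{Z})$, $M_{\mathbb{R}} = M\otimes\mathbb{R}$, with pairing $\langle\cdot,\cdot\rangle : M_{\mathbb{R}}\times N_{\mathbb{R}}\to\mathbb{R}$. A lattice polytope $\Delta\subseteq N_{\mathbb{R}}$ with the origin in its interior is called reflexive if the dual polytope $\Delta^* = \{ m\in M_{\mathbb{R}} \mid \langle m,n\rangle\ge -1 \ \forall n\in\Delta\}$ is also a lattice polytope (with respect to $M$). The cone over a subset $S$ of a real vector space is $\mathbb{R}_{\ge 0}S = \{rs \mid r\in\mathbb{R}, r\ge 0, s\in S\}$. The fan $\Sigma(\Delta)$ consists of the cones over the proper faces of $\Delta$, and $X(\Delta)$ is the (complex) toric variety of the fan $\Sigma(\Delta)$. The intersection fan of two complete fans $\Sigma,\Sigma'$ in $N_{\mathbb{R}}$ is the fan whose cones are all intersections $C\cap C'$ with $C\in\Sigma$, $C'\in\Sigma'$. A complete fan $F_2$ is a refinement of a complete fan $F_1$ if every cone of $F_2$ is contained in a cone of $F_1$. *)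

(* Defs.v *)
(* MathComp with MathComp-Analysis and the complex numbers R[i] of
   MathComp real-closed. *)
From HB Require Import structures.
From Stdlib Require Import Relation_Operators.
From mathcomp Require Import all_boot all_order all_algebra.
From mathcomp Require Import all_classical all_reals all_analysis.
From mathcomp Require Import complex.

Set Implicit Arguments.
Unset Strict Implicit.
Unset Printing Implicit Defensive.

Import Order.TTheory GRing.Theory Num.Theory.
Import numFieldNormedType.Exports.

Local Open Scope classical_set_scope.
Local Open Scope ring_scope.
Local Open Scope complex_scope.

(* N = Z^n and M = Hom(N, Z) are both 'rV[int]_n, and N_R, M_R are both
   'rV[R]_n: M is identified with Z^n through the dual of the standard basis,
   so that the pairing M_R x N_R -> R is the dot product. *)
Section Polytopes.
Variables (R : realType) (n : nat).

Definition realvec (v : 'rV[int]_n) : 'rV[R]_n := map_mx intr v.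

Definition pairing (m x : 'rV[R]_n) : R := \sum_(j < n) m 0 j * x 0 j.

Definition Conv (s : seq 'rV[R]_n) : set 'rV[R]_n :=
  [set x | exists a : 'I_(size s) -> R,
    [/\ forall i, 0 <= a i, \sum_i a i = 1 & x = \sum_i a i *: s`_i]].

Definition lattice_polytope (P : set 'rV[R]_n) : Prop :=
  exists s : seq 'rV[int]_n, P = Conv (map realvec s).

Definition dual_polytope (P : set 'rV[R]_n) : set 'rV[R]_n :=
  [set m | forall x, P x -> -1 <= pairing m x].

Definition reflexive_polytope (P : set 'rV[R]_n) : Prop :=
  [/\ lattice_polytope P, interior P 0 & lattice_polytope (dual_polytope P)].

(* m = 0 shows that P is a face of itself, and also (with c < 0) that the
   empty set is a face. *)
Definition is_face (P F : set 'rV[R]_n) : Prop :=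
  exists (m : 'rV[R]_n) (c : R),
    (forall x, P x -> c <= pairing m x) /\
    F = [set x | P x /\ pairing m x = c].

Definition proper_face (P F : set 'rV[R]_n) : Prop := is_face P F /\ F <> P.

(* The origin is added explicitly, so that the cone over the empty face is the
   zero cone; for nonempty S it is already of the form r *: s with r = 0. *)
Definition cone_over (S : set 'rV[R]_n) : set 'rV[R]_n :=
  [set 0] `|` [set x | exists r s, [/\ 0 <= r, S s & x = r *: s]].

(* A fan is given by its set of cones. *)
Definition face_fan (P : set 'rV[R]_n) : set (set 'rV[R]_n) :=
  [set cone_over F | F in proper_face P].

Definition intersection_fan (Sigma Sigma' : set (set 'rV[R]_n)) :
    set (set 'rV[R]_n) :=
  [set K | exists C C', [/\ Sigma C, Sigma' C' & K = C `&` C']].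

Definition refines (F2 F1 : set (set 'rV[R]_n)) : Prop :=
  forall C, F2 C -> exists2 C', F1 C' & C `<=` C'.

End Polytopes.

(* A variety over K in the classical sense: a set of closed points with its
   Zariski-open sets and, on each of them, its K-valued regular functions. The
   functions are total, but only their values on the open set matter. *)
Record space_with_functions (K : Type) := SpaceWithFunctions {
  sp_point :> Type;
  sp_open : set (set sp_point);
  sp_regular : set sp_point -> set (sp_point -> K) }.

Definition is_morphism (K : Type) (X Y : space_with_functions K)
    (phi : X -> Y) : Prop :=
  forall V : set Y, sp_open V ->
    sp_open (phi @^-1` V) /\
    forall f : Y -> K, sp_regular V f -> sp_regular (phi @^-1` V) (f \o phi).

Section ToricVariety.
Variables (R : realType) (n : nat).
Implicit Types sigma : set 'rV[R]_n.

(* S_sigma = sigma^dual `&` M *)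
Definition dual_semigroup sigma : set 'rV[int]_n :=
  [set m | forall x, sigma x -> 0 <= pairing (realvec R m) x].

(* The closed points of U_sigma = Spec C[S_sigma] are the monoid morphisms
   from S_sigma to the multiplicative monoid C. Such a morphism is represented
   by its extension by 0 to M, which makes the representation unique. *)
Definition affine_point sigma (x : 'rV[int]_n -> R[i]) : Prop :=
  [/\ x 0 = 1,
      forall m m', dual_semigroup sigma m -> dual_semigroup sigma m' ->
        x (m + m') = x m * x m' &
      forall m, ~ dual_semigroup sigma m -> x m = 0].

(* The elements of C[S_sigma], as functions of the point: finite linear
   combinations of the characters chi^m : x |-> x m with m in S_sigma. *)
Definition coordinate_function sigma (g : ('rV[int]_n -> R[i]) -> R[i]) : Prop :=
  exists s : seq (R[i] * 'rV[int]_n),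
    (forall a, a \in s -> dual_semigroup sigma a.2) /\
    (forall x, g x = \sum_(a <- s) a.1 * x a.2).

(* The Zariski tangent space of U_sigma at x, as the space of C-linear maps
   D : C[S_sigma] -> C with D(f g) = f(x) D(g) + g(x) D(f). As the chi^m form a
   basis of C[S_sigma] stable under products, D is given by its values D(chi^m)
   and the Leibniz rule has to be required on the chi^m only. Again D is
   extended by 0 outside S_sigma. *)
Definition tangent_vector sigma (x D : 'rV[int]_n -> R[i]) : Prop :=
  (forall m m', dual_semigroup sigma m -> dual_semigroup sigma m' ->
     D (m + m') = x m * D m' + x m' * D m) /\
  (forall m, ~ dual_semigroup sigma m -> D m = 0).

Definition tangent_space_has_dim sigma (x : 'rV[int]_n -> R[i]) (d : nat) :
    Prop :=
  exists b : 'I_d -> 'rV[int]_n -> R[i],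
    (forall i, tangent_vector sigma x (b i)) /\
    (forall D, tangent_vector sigma x D ->
       exists! a : 'rV[R[i]]_d, forall m, D m = \sum_i a 0 i * b i m).

Variable Sigma : set (set 'rV[R]_n).

(* X(Sigma) has dimension n and is covered by the open subvarieties U_sigma. *)
Definition toric_smooth : Prop :=
  forall sigma, Sigma sigma ->
  forall x, affine_point sigma x -> tangent_space_has_dim sigma x n.

(* The points of the disjoint union of the U_sigma, for sigma in Sigma *)
Record chart_point := ChartPoint {
  chart_cone : set 'rV[R]_n;
  chart_coneP : Sigma chart_cone;
  chart_pt : 'rV[int]_n -> R[i];
  chart_ptP : affine_point chart_cone chart_pt }.

(* U_sigma and U_tau are glued along U_(sigma `&` tau), whose open immersions
   into them restrict a morphism to S_sigma and to S_tau respectively. *)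
Definition glued (p q : chart_point) : Prop :=
  exists z, [/\ affine_point (chart_cone p `&` chart_cone q) z,
    forall m, dual_semigroup (chart_cone p) m -> chart_pt p m = z m &
    forall m, dual_semigroup (chart_cone q) m -> chart_pt q m = z m].

(* When Sigma is a fan, glued is already an equivalence relation. *)
Definition toric_point : Type :=
  {P : set chart_point |
    exists p, P = [set q | clos_refl_sym_trans chart_point glued p q]}.

Definition toric_class (p : chart_point) : toric_point :=
  exist _ [set q | clos_refl_sym_trans chart_point glued p q]
          (ex_intro _ p erefl).

Definition toric_open (U : set toric_point) : Prop :=
  forall p, U (toric_class p) ->
  exists g, [/\ coordinate_function (chart_cone p) g,
    g (chart_pt p) != 0 &
    forall q, chart_cone q = chart_cone p -> g (chart_pt q) != 0 ->
      U (toric_class q)].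

Definition toric_regular (U : set toric_point) (f : toric_point -> R[i]) :
    Prop :=
  forall p, U (toric_class p) ->
  exists g h, [/\ coordinate_function (chart_cone p) g,
    coordinate_function (chart_cone p) h,
    h (chart_pt p) != 0 &
    forall q, chart_cone q = chart_cone p -> U (toric_class q) ->
      h (chart_pt q) != 0 ->
      f (toric_class q) = g (chart_pt q) / h (chart_pt q)].

Definition toric_variety : space_with_functions R[i] :=
  SpaceWithFunctions toric_open toric_regular.

End ToricVariety.

(* The lattice map v |-> v *m A from Z^n to Z^n' has dual m' |-> m' *m A^T, and
   induces the morphism of tori t |-> (m' |-> t (m' *m A^T)). The torus of
   X(Sigma) is the chart of the zero cone, which belongs to every fan. The
   lattice map induces a toric morphism if the morphism of tori extends to a
   morphism of varieties. *)
Definition induces_toric_morphism (R : realType) (n n' : nat)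
    (Sigma : set (set 'rV[R]_n)) (Sigma' : set (set 'rV[R]_n'))
    (A : 'M[int]_(n, n')) : Prop :=
  exists phi : toric_variety Sigma -> toric_variety Sigma',
    is_morphism phi /\
    forall (p : chart_point Sigma) (q : chart_point Sigma'),
      chart_cone p = [set 0] -> chart_cone q = [set 0] ->
      (forall m', chart_pt q m' = chart_pt p (m' *m A^T)) ->
      phi (toric_class p) = toric_class q.

Definition vec4 (a b c d : int) : 'rV[int]_4 := \row_(j < 4) [:: a; b; c; d]`_j.

Definition Delta1 (R : realType) : set 'rV[R]_4 :=
  Conv (map (@realvec R 4)
    [:: vec4 1 0 0 0; vec4 0 1 0 0; vec4 0 0 1 0; vec4 0 0 0 1;
        vec4 (-1) (-1) (-1) (-1)]).

Definition Delta2 (R : realType) : set 'rV[R]_4 :=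
  Conv (map (@realvec R 4)
    [:: vec4 1 0 0 0; vec4 0 1 0 0; vec4 0 0 1 0; vec4 0 0 0 1;
        vec4 (-1) (-1) (-1) (-1); vec4 1 1 1 1; vec4 0 0 0 (-1)]).

Arguments Delta1 R : clear implicits.
Arguments Delta2 R : clear implicits.

(* Main.v *)
Require Import Defs.
From mathcomp Require Import all_boot all_order all_algebra.
From mathcomp Require Import all_classical all_reals.
From Stdlib Require Import Relation_Operators.
From mathcomp Require Import all_analysis complex ring lra zify.

Set Implicit Arguments.
Unset Strict Implicit.
Unset Printing Implicit Defensive.

Import Order.TTheory GRing.Theory Num.Theory.
Import numFieldNormedType.Exports.

Local Open Scope classical_set_scope.
Local Open Scope ring_scope.

(** Smoothness: every cone of either fan is spanned by part of a lattice basis,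
    so its dual semigroup is N^r x Z^(n - r) and the partial derivatives in the
    dual basis form a basis of each tangent space.

    No morphism: let f = (1,1,1,1) and g = (0,0,0,-1). The cone over [f, g] lies
    in no cone of Sigma(Delta1), since f needs e1, ..., e4 and g needs
    -(1,1,1,1). Let p be its distinguished point; every curve l |-> l^(a f + b g)
    with a, b > 0 tends to p as l -> 0. If phi extended the identity of the
    torus, then phi(p) would have a nonzero homogeneous coordinate x_k in
    X(Delta1) = P^4, so every x_i / x_k would pull back to a regular function
    near p. For suitable i, a and b, however, x_i / x_k has a pole along the
    curve. *)

(** * Cones over faces of lattice polytopes *)

Section Cones.
Variables (R : realType) (n : nat).
Implicit Types (m x y : 'rV[R]_n) (s : seq 'rV[R]_n) (c : R).

Lemma pairingC m x : pairing m x = pairing x m.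
Proof. by apply: eq_bigr => j _; rewrite mulrC. Qed.

Lemma pairingZr m c x : pairing m (c *: x) = c * pairing m x.
Proof. by rewrite /pairing mulr_sumr; apply: eq_bigr => j _; rewrite mxE mulrCA. Qed.

Lemma pairing_sumr m (I : finType) (y : I -> 'rV[R]_n) :
  pairing m (\sum_i y i) = \sum_i pairing m (y i).
Proof.
rewrite /pairing exchange_big; apply: eq_bigr => j _.
by rewrite summxE mulr_sumr.
Qed.

Lemma pairing_combr m (I : finType) (a : I -> R) (y : I -> 'rV[R]_n) :
  pairing m (\sum_i a i *: y i) = \sum_i a i * pairing m (y i).
Proof. by rewrite pairing_sumr; apply: eq_bigr => i _; rewrite pairingZr. Qed.

Lemma Conv_vertex s (i : 'I_(size s)) : Conv s s`_i.
Proof.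
exists (fun j => (j == i)%:R); split.
- by move=> j; rewrite ler0n.
- by rewrite (bigD1 i) //= eqxx big1 ?addr0 // => j /negPf ->.
- by rewrite (bigD1 i) //= eqxx scale1r big1 ?addr0 // => j /negPf ->; rewrite scale0r.
Qed.

Lemma Conv_ge s m c :
  (forall i : 'I_(size s), c <= pairing m s`_i) ->
  forall x, Conv s x -> c <= pairing m x.
Proof.
move=> h x [a [a0 a1 ->]]; rewrite pairing_combr -[c]mul1r -a1 mulr_suml.
by apply: ler_sum => i _; apply: ler_wpM2l.
Qed.

Lemma dual_polytope_Conv s m :
  dual_polytope (Conv s) m <-> forall i : 'I_(size s), -1 <= pairing m s`_i.
Proof.
split=> [h i|h]; first by apply: h; apply: Conv_vertex.
exact: Conv_ge.
Qed.

(** Generators of the cone over the face cut out by [m] and [c]. The weights range over all vertices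
    and are forced to vanish off the face, so a single index type serves every face. *)
Definition face_cone s m c : set 'rV[R]_n :=
  [set x | exists a : 'I_(size s) -> R,
    [/\ forall i, 0 <= a i, forall i : 'I_(size s), pairing m s`_i != c -> a i = 0 &
        x = \sum_i a i *: s`_i]].

Lemma face_cone_vertex s m c (i : 'I_(size s)) :
  pairing m s`_i = c -> face_cone s m c s`_i.
Proof.
move=> hi; exists (fun j => (j == i)%:R); split.
- by move=> j; rewrite ler0n.
- by move=> j; case: (j =P i) => [->|//]; rewrite hi eqxx.
- by rewrite (bigD1 i) //= eqxx scale1r big1 ?addr0 // => j /negPf ->; rewrite scale0r.
Qed.

Lemma cone_over_face s m c :
  (forall i : 'I_(size s), c <= pairing m s`_i) ->
  cone_over [set x | Conv s x /\ pairing m x = c] = face_cone s m c.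
Proof.
move=> h; apply/seteqP; split => x.
  case=> [->|[r [y [r0 [[a [a0 a1 ->]] my] ->]]]].
    exists (fun=> 0); split => //; rewrite big1 // => i _; exact: scale0r.
  exists (fun i => r * a i); split.
  - by move=> i; rewrite mulr_ge0.
  - move=> i hi; suff -> : a i = 0 by rewrite mulr0.
    have sum0 : \sum_j a j * (pairing m s`_j - c) = 0.
      under eq_bigr do rewrite mulrBr.
      by rewrite sumrB -mulr_suml a1 mul1r -pairing_combr my subrr.
    have F0 (j : 'I_(size s)) : true -> 0 <= a j * (pairing m s`_j - c).
      by rewrite mulr_ge0 // subr_ge0.
    have /eqP := psumr_eq0P F0 sum0 (i := i) isT.
    by rewrite mulf_eq0 subr_eq0 (negPf hi) orbF => /eqP.
  - by rewrite scaler_sumr; apply: eq_bigr => i _; rewrite scalerA.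
move=> [a [a0 ac ->]]; pose r := \sum_i a i.
(* Total weight 0 gives the origin, which also covers the empty face. *)
have [r0|r0] := eqVneq r 0.
  left => /=; apply: big1 => i _.
  by rewrite (psumr_eq0P (fun j _ => a0 j) r0 (i := i) isT) scale0r.
right; exists r, (\sum_i (a i / r) *: s`_i); split.
- exact: sumr_ge0.
- split; last first.
    rewrite pairing_combr -[c]mul1r -(divff r0) {2}/r !mulr_suml; apply: eq_bigr => i _.
    have [-> //|/ac ->] := eqVneq (pairing m s`_i) c; by rewrite !mul0r.
  exists (fun i => a i / r); split => //.
    by move=> i; rewrite divr_ge0 // sumr_ge0.
  by rewrite -mulr_suml divff.
- rewrite scaler_sumr; apply: eq_bigr => i _.
  by rewrite scalerA mulrCA divff // mulr1.
Qed.

(** A face is proper exactly when some vertex lies off its hyperplane, because an equality at all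
    vertices extends to the whole hull. *)
Lemma face_fan_Conv s C :
  face_fan (Conv s) C <->
  exists m c, [/\ forall i : 'I_(size s), c <= pairing m s`_i,
    exists i : 'I_(size s), pairing m s`_i != c & C = face_cone s m c].
Proof.
split=> [[F [[m [c [h ->]]] Fp] <-]|[m [c [h [i hi] ->]]]].
  have h' (i : 'I_(size s)) : c <= pairing m s`_i by apply: h; exact: Conv_vertex.
  exists m, c; split => //; last exact: cone_over_face.
  apply: contrapT => hn; apply: Fp; apply/seteqP; split=> [x []//|x sx] /=; split=> //.
  case: sx => a [_ a1 ->]; rewrite pairing_combr -[c]mul1r -a1 mulr_suml.
  apply: eq_bigr => i _; have [-> //|hi] := eqVneq (pairing m s`_i) c.
  by case: hn; exists i.
exists [set x | Conv s x /\ pairing m x = c]; last exact: cone_over_face.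
split; first by exists m, c; split => //; apply: Conv_ge.
move=> /seteqP[_ /(_ _ (Conv_vertex i))] [_ /eqP]; by rewrite (negPf hi).
Qed.

End Cones.

(** * Integral pairing and dual semigroups *)

Section LatticePairing.
Variables (R : realType) (n : nat).
Implicit Types m w : 'rV[int]_n.

Definition ipair m w : int := \sum_j m 0 j * w 0 j.

Lemma pairing_realvec m w :
  pairing (realvec R m) (realvec R w) = (ipair m w)%:~R.
Proof.
by rewrite /pairing /ipair rmorph_sum; apply: eq_bigr => j _; rewrite !mxE rmorphM.
Qed.

Lemma ipair0l w : ipair 0 w = 0.
Proof. by apply: big1 => j _; rewrite mxE mul0r. Qed.

Lemma ipairDl m m' w : ipair (m + m') w = ipair m w + ipair m' w.
Proof.
by rewrite /ipair -big_split; apply: eq_bigr => j _; rewrite mxE mulrDl.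
Qed.

Lemma ipairNl m w : ipair (- m) w = - ipair m w.
Proof. by rewrite /ipair -sumrN; apply: eq_bigr => j _; rewrite mxE mulNr. Qed.

Lemma ipairDr m w w' : ipair m (w + w') = ipair m w + ipair m w'.
Proof.
by rewrite /ipair -big_split; apply: eq_bigr => j _; rewrite mxE mulrDr.
Qed.

Lemma ipairMnr m w k : ipair m (w *+ k) = ipair m w *+ k.
Proof.
by rewrite /ipair -sumrMnl; apply: eq_bigr => j _; rewrite mulmxnE mulrnAr.
Qed.

Lemma dual_semigroup0 (sigma : set 'rV[R]_n) : dual_semigroup sigma 0.
Proof.
by move=> x _; rewrite /pairing big1 // => j _; rewrite !mxE mul0r.
Qed.

Lemma dual_semigroupD (sigma : set 'rV[R]_n) m m' :
  dual_semigroup sigma m -> dual_semigroup sigma m' -> dual_semigroup sigma (m + m').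
Proof.
move=> h h' x sx; move: (addr_ge0 (h x sx) (h' x sx)).
rewrite /pairing -big_split; congr (0 <= _); apply: eq_bigr => j _ /=.
by rewrite !mxE rmorphD mulrDl.
Qed.

Lemma dual_semigroupS (sigma tau : set 'rV[R]_n) m :
  sigma `<=` tau -> dual_semigroup tau m -> dual_semigroup sigma m.
Proof. by move=> st h x /st /h. Qed.

Lemma dual_semigroup_face_cone (L : seq 'rV[int]_n) (u : 'rV[R]_n) c m :
  dual_semigroup (face_cone (map (@realvec R n) L) u c) m <->
  forall k, (k < size L)%N -> pairing u (realvec R L`_k) = c -> 0 <= ipair m L`_k.
Proof.
split=> [h k kL uk|h x [a [a0 ac ->]]].
  rewrite -(ler0z R) -pairing_realvec; apply: h.
  have kL' : (k < size (map (@realvec R n) L))%N by rewrite size_map.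
  rewrite -(nth_map 0 0) //; apply: (face_cone_vertex (i := Ordinal kL')) => /=.
  by rewrite (nth_map 0).
rewrite pairing_combr; apply: sumr_ge0 => i _.
have iL : (i < size L)%N by have := ltn_ord i; rewrite [X in (_ < X)%N]size_map.
have [hi|/ac ->] := eqVneq (pairing u (map (@realvec R n) L)`_i) c; last by rewrite mul0r.
by rewrite mulr_ge0 // (nth_map 0) // pairing_realvec ler0z h // -hi (nth_map 0).
Qed.

(** Duality says [D *m B = 1]; for square matrices over a commutative ring this gives [B *m D = 1],
    and the expansion is [m *m B *m D]. *)
Lemma dual_basis_expand (b d : 'I_n -> 'rV[int]_n) m :
  (forall i j, ipair (d i) (b j) = (i == j)%:R) -> m = \sum_i ipair m (b i) *: d i.
Proof.
move=> db; pose D : 'M[int]_n := \matrix_(i, j) d i 0 j.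
pose B : 'M[int]_n := \matrix_(i, j) b j 0 i.
have /mulmx1C BD : D *m B = 1%:M.
  apply/matrixP => i j; rewrite !mxE -db; apply: eq_bigr => k _; by rewrite !mxE.
rewrite -[LHS]mulmx1 -BD mulmxA; apply/rowP => j; rewrite mxE summxE.
apply: eq_bigr => i _; rewrite !mxE; congr (_ * _).
by apply: eq_bigr => k _; rewrite mxE.
Qed.

End LatticePairing.

(** * Tangent spaces of smooth cones *)

Section SmoothCone.
Variables (R : realType) (n : nat) (sigma : set 'rV[R]_n).
(** [b] is a lattice basis with dual basis [d], and [K] selects the basis vectors that generate the
    cone. For [i] outside [K] the character of [d i] is invertible on the chart. *)
Variables (b d : 'I_n -> 'rV[int]_n) (K : pred 'I_n).
Hypothesis db : forall i j, ipair (d i) (b j) = (i == j)%:R.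
Hypothesis SE : forall m, dual_semigroup sigma m <-> forall i, K i -> 0 <= ipair m (b i).
Local Open Scope complex_scope.
Variable x : 'rV[int]_n -> R[i].
Hypothesis xP : affine_point sigma x.

Local Notation S := (dual_semigroup sigma).

Let x0 : x 0 = 1. Proof. by case: xP. Qed.
Let xD m m' : S m -> S m' -> x (m + m') = x m * x m'. Proof. by case: xP => _ + _; apply. Qed.

(* The i-th partial derivative of chi^m in the coordinates chi^(d j). *)
Definition coordinate_derivative i (m : 'rV[int]_n) : R[i] :=
  if `[< S m >] then (ipair m (b i))%:~R * x (m - d i) else 0.

Let S0 : S 0. Proof. exact: dual_semigroup0. Qed.

(** For [i] in [K] a nonzero pairing is at least 1, so it remains nonnegative after subtracting
    [d i]; the other pairings do not change. *)
Let S_sub_d i m : S m -> ipair m (b i) != 0 -> S (m - d i).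
Proof.
move=> /SE Sm mi; apply/SE => j Kj; rewrite ipairDl ipairNl db.
have := Sm j Kj; have [<-|_] := eqVneq i j; last by rewrite subr0.
by move: mi => /eqP /=; lia.
Qed.

Lemma coordinate_derivative_tangent i : tangent_vector sigma x (coordinate_derivative i).
Proof.
split=> [m m' Sm Sm'|m Sm]; last by rewrite /coordinate_derivative asboolF.
rewrite /coordinate_derivative !asboolT //; last exact: dual_semigroupD.
(* One half of the Leibniz rule. If the pairing is 0, both sides vanish whatever the value of [x] at
   [p' - d i]. *)
have E p p' : S p -> S p' ->
    (ipair p' (b i))%:~R * x (p + p' - d i) = x p * ((ipair p' (b i))%:~R * x (p' - d i)).
  move=> Sp Sp'; have [->|nz] := eqVneq (ipair p' (b i)) 0.
    by rewrite !mul0r mulr0.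
  by rewrite -addrA (xD Sp (S_sub_d Sp' nz)) mulrCA.
by rewrite -E // -E // ipairDl rmorphD mulrDl addrC [m' + m]addrC.
Qed.

Let Sd i : S (d i).
Proof. by apply/SE => j _; rewrite db ler0n. Qed.

Lemma coordinate_derivative_dual i j : coordinate_derivative i (d j) = (j == i)%:R.
Proof.
rewrite /coordinate_derivative asboolT // db.
by have [->|_] := eqVneq j i; rewrite ?mul0r // subrr x0 mulr1.
Qed.

(** By the Leibniz rule the elements of [S] killed by [D] are closed under addition, and [S] is
    generated by the [d i] together with [- d i] for [i] outside [K]. *)
Lemma tangent_vector_eq0 D :
  tangent_vector sigma x D -> (forall i, D (d i) = 0) -> forall m, D m = 0.
Proof.
move=> [DD D0] Dd m.
have [Sm|/D0//] := pselect (S m).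
have Dz : D 0 = 0.
  have := DD 0 0 S0 S0.
  by rewrite addr0 x0 !mul1r => /eqP; rewrite -subr_eq0 opprD addNKr oppr_eq0 => /eqP.
have DDz p q : S p -> S q -> D p = 0 -> D q = 0 -> D (p + q) = 0.
  by move=> Sp Sq p0 q0; rewrite DD // p0 q0 !mulr0 addr0.
have Dmulrn i p : S p -> D p = 0 -> forall k, S (p *+ k) /\ D (p *+ k) = 0.
  move=> Sp p0; elim=> [|k [IH1 IH2]]; first by rewrite mulr0n; split.
  by rewrite mulrS; split; [exact: dual_semigroupD|exact: DDz].
have Dmul i (a : int) : (K i -> 0 <= a) -> S (a *: d i) /\ D (a *: d i) = 0.
  case: a => k ha; first by rewrite -[Posz k]intz scaler_int -pmulrn; apply: Dmulrn.
  have nK : ~~ K i by apply/negP => /ha; lia.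
  have SN : S (- d i).
    by apply/SE => j Kj; rewrite ipairNl db; have [ij|_] := eqVneq i j; [rewrite ij Kj in nK|].
  (* Differentiate the product of the characters of [d i] and [- d i], which is 1; the value of [x]
     at [d i] is then a unit. *)
  have DN : D (- d i) = 0.
    have := DD _ _ (Sd i) SN; rewrite subrr Dz Dd mulr0 addr0 => /esym/eqP.
    rewrite mulf_eq0 => /orP[/eqP xd|/eqP //].
    by have := xD (Sd i) SN; rewrite subrr x0 xd mul0r => /eqP; rewrite oner_eq0.
  by rewrite -[Negz k]intz scaler_int NegzE mulrNz -pmulrn -mulNrn; apply: Dmulrn.
rewrite (dual_basis_expand m db).
suff [//] : S (\sum_i ipair m (b i) *: d i) /\ D (\sum_i ipair m (b i) *: d i) = 0.
apply: (big_ind (fun p => S p /\ D p = 0)).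
- by split.
- by move=> p q [Sp p0] [Sq q0]; split; [exact: dual_semigroupD|exact: DDz].
- by move=> i _; apply: Dmul => Ki; move/SE: Sm; apply.
Qed.

(** Subtracting from [D] the combination of partial derivatives with coefficients [D (d i)] leaves a
    tangent vector that vanishes on the coordinates. Evaluation at [d j] gives uniqueness. *)
Lemma smooth_cone : tangent_space_has_dim sigma x n.
Proof.
exists coordinate_derivative; split=> [i|D DP]; first exact: coordinate_derivative_tangent.
exists (\row_i D (d i)); split=> [m|a aP]; last first.
  apply/rowP => j; rewrite mxE aP (bigD1 j) //= coordinate_derivative_dual eqxx mulr1.
  rewrite big1 ?addr0 // => i ij; rewrite coordinate_derivative_dual eq_sym.
  by rewrite (negPf ij) mulr0.
pose E m := D m - \sum_i D (d i) * coordinate_derivative i m.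
suff /eqP : E m = 0.
  by rewrite subr_eq0 => /eqP ->; apply: eq_bigr => i _; rewrite mxE.
apply: tangent_vector_eq0 => [|j]; last first.
  rewrite /E (bigD1 j) //= coordinate_derivative_dual eqxx mulr1 big1 ?addr0 ?subrr //.
  by move=> i ij; rewrite coordinate_derivative_dual eq_sym (negPf ij) mulr0.
have cdP := fun i => coordinate_derivative_tangent i.
case: DP => DD D0; split=> [p q Sp Sq|p Sp]; rewrite /E; last first.
  rewrite D0 // big1 ?subrr // => i _.
  by have [_ -> //] := cdP i; rewrite mulr0.
have -> : \sum_i D (d i) * coordinate_derivative i (p + q) =
   x p * (\sum_i D (d i) * coordinate_derivative i q) +
   x q * (\sum_i D (d i) * coordinate_derivative i p).
  rewrite !mulr_sumr -big_split; apply: eq_bigr => i _.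
  by have [-> //] := cdP i; rewrite mulrDr !(mulrCA (D _)).
by rewrite DD // !mulrBr opprD addrACA.
Qed.

End SmoothCone.

(** * Combinations of lattice vectors with weights indexed by [nat] *)

Section NatIndexedCombinations.
Variables (R : realType) (n : nat).
Implicit Types (L : seq 'rV[int]_n) (x u : 'rV[R]_n) (a : nat -> R).

(** Weights on [nat] let explicit lists [nth 0 [:: ...]] serve as witnesses. *)
Definition lattice_comb L a : 'rV[R]_n := \sum_(k < size L) a k *: realvec R L`_k.

Let extend N (a : 'I_N -> R) (k : nat) : R := if insub k is Some i then a i else 0.

Let extend_ge0 N (a : 'I_N -> R) : (forall i, 0 <= a i) -> forall k, 0 <= extend a k.
Proof. by move=> a0 k; rewrite /extend; case: insubP. Qed.

Let extendE N (a : 'I_N -> R) (i : 'I_N) : extend a i = a i.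
Proof. by rewrite /extend valK. Qed.

Let sum_extend L (a : 'I_(size (map (@realvec R n) L)) -> R) :
  \sum_i a i *: (map (@realvec R n) L)`_i = lattice_comb L (extend a).
Proof.
rewrite /lattice_comb -(size_map (@realvec R n) L).
apply: eq_bigr => i _; rewrite extendE (nth_map 0) //.
by have := ltn_ord i; rewrite [X in (_ < X)%N]size_map.
Qed.

Let lattice_comb_map L a :
  lattice_comb L a = \sum_(i < size (map (@realvec R n) L)) a i *: (map (@realvec R n) L)`_i.
Proof.
rewrite /lattice_comb -(size_map (@realvec R n) L).
apply: eq_bigr => i _; rewrite (nth_map 0) //.
by have := ltn_ord i; rewrite [X in (_ < X)%N]size_map.
Qed.

Lemma Conv_lattice_comb L x :
  Conv (map (@realvec R n) L) x <->
  exists a, [/\ forall k, 0 <= a k, \sum_(k < size L) a k = 1 & x = lattice_comb L a].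
Proof.
split=> [[a [a0 a1 ->]]|[a [a0 a1 ->]]].
  exists (extend a); split; [exact: extend_ge0| |exact: sum_extend].
  rewrite -a1 -(size_map (@realvec R n) L).
  by apply: eq_bigr => i _; rewrite extendE.
exists (fun i => a i); split=> [//| |]; last exact: lattice_comb_map.
by rewrite -a1 -(size_map (@realvec R n) L).
Qed.

Lemma face_cone_lattice_comb L u c x :
  face_cone (map (@realvec R n) L) u c x <->
  exists a, [/\ forall k, 0 <= a k,
    forall k, (k < size L)%N -> pairing u (realvec R L`_k) != c -> a k = 0 &
    x = lattice_comb L a].
Proof.
split=> [[a [a0 ac ->]]|[a [a0 ac ->]]].
  exists (extend a); split; [exact: extend_ge0| |exact: sum_extend].
  move=> k kL kc; have kL' : (k < size (map (@realvec R n) L))%N by rewrite size_map.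
  by rewrite -[k]/(nat_of_ord (Ordinal kL')) extendE ac //= (nth_map 0).
exists (fun i => a i); split=> [//| |]; last exact: lattice_comb_map.
move=> i; have iL : (i < size L)%N by have := ltn_ord i; rewrite [X in (_ < X)%N]size_map.
by rewrite (nth_map 0) //; apply: ac.
Qed.

Lemma face_fan_lattice L C :
  face_fan (Conv (map (@realvec R n) L)) C <->
  exists u c, [/\ forall k, (k < size L)%N -> c <= pairing u (realvec R L`_k),
    exists2 k, (k < size L)%N & pairing u (realvec R L`_k) != c &
    C = face_cone (map (@realvec R n) L) u c].
Proof.
have E (i : 'I_(size (map (@realvec R n) L))) :
    (i < size L)%N /\ (map (@realvec R n) L)`_i = realvec R L`_i.
  have iL : (i < size L)%N by have := ltn_ord i; rewrite [X in (_ < X)%N]size_map.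
  by rewrite (nth_map 0).
rewrite face_fan_Conv; split=> -[u [c [h hi ->]]]; exists u, c; split => //.
- move=> k kL; have kL' : (k < size (map (@realvec R n) L))%N by rewrite size_map.
  by have := h (Ordinal kL'); rewrite /= (nth_map 0).
- by case: hi => i; have [iL ->] := E i; exists i.
- by move=> i; have [iL ->] := E i; apply: h.
- case: hi => k kL; have kL' : (k < size (map (@realvec R n) L))%N by rewrite size_map.
  by exists (Ordinal kL'); rewrite /= (nth_map 0).
Qed.

Lemma Conv_lattice_prefix L L' :
  Conv (map (@realvec R n) L) `<=` Conv (map (@realvec R n) (L ++ L')).
Proof.
move=> x /Conv_lattice_comb[a [a0 a1 ->]]; apply/Conv_lattice_comb.
pose a' k := if (k < size L)%N then a k else 0.
have E (V : zmodType) (F : nat -> V) : (forall k, (size L <= k)%N -> F k = 0) ->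
    \sum_(k < size (L ++ L')) F k = \sum_(k < size L) F k.
  move=> F0; rewrite size_cat big_split_ord /= [X in _ + X]big1 ?addr0 // => k _.
  by rewrite F0 // leq_addr.
exists a'; split.
- by move=> k; rewrite /a'; case: ifP.
- rewrite -a1 E => [|k]; last by rewrite /a' ltnNge => ->.
  by apply: eq_bigr => k _; rewrite /a' ltn_ord.
- rewrite [RHS](E _ (fun k => a' k *: realvec R (L ++ L')`_k)) => [|k]; last first.
    by rewrite /a' ltnNge => ->; rewrite scale0r.
  by apply: eq_bigr => k _; rewrite /a' nth_cat !ltn_ord.
Qed.

(** [f] lists the positions of [n] vertices forming a lattice basis with dual basis [d]. It contains
    all vertices of the face and possibly others, so [K] picks out those on the face. *)
Lemma smooth_face_cone L u c (f : seq nat) (d : seq 'rV[int]_n) :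
  (forall k, (k < size L)%N -> pairing u (realvec R L`_k) = c -> k \in f) ->
  size f = n -> all (fun k => k < size L)%N f ->
  (forall i j, (i < n)%N -> (j < n)%N -> ipair d`_i L`_(nth 0%N f j) = (i == j)%:R) ->
  forall t, affine_point (face_cone (map (@realvec R n) L) u c) t ->
  tangent_space_has_dim (face_cone (map (@realvec R n) L) u c) t n.
Proof.
move=> facef fn /allP fL df t tP.
pose K : pred 'I_n := fun j => pairing u (realvec R L`_(nth 0%N f j)) == c.
apply: (smooth_cone (b := fun j : 'I_n => L`_(nth 0%N f j))
  (d := fun i : 'I_n => d`_i) (K := K)) => //.
- by move=> i j; rewrite df.
- move=> m; rewrite dual_semigroup_face_cone; split=> [h i /eqP Ki|h k kL kc].
    by apply: h => //; apply: fL; rewrite mem_nth // fn.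
  have kf := facef k kL kc; have i_n : (index k f < n)%N by rewrite -fn index_mem.
  by have := h (Ordinal i_n); rewrite /K /= nth_index //; apply; apply/eqP.
Qed.

End NatIndexedCombinations.

(** * The two polytopes *)

Section Vec4.
Variables (R : realType).
Implicit Types (a b c d : int) (u : 'rV[R]_4).

Definition o4 (k : nat) : 'I_4 := inord k.

Lemma sum_ord4 (V : nmodType) (F : 'I_4 -> V) :
  \sum_i F i = F (o4 0) + F (o4 1) + F (o4 2) + F (o4 3).
Proof.
rewrite !big_ord_recl big_ord0 addr0 !addrA.
by congr (F _ + F _ + F _ + F _); apply: val_inj; rewrite /= inordK.
Qed.

Lemma row4P (T : Type) (x y : 'rV[T]_4) :
  x 0 (o4 0) = y 0 (o4 0) -> x 0 (o4 1) = y 0 (o4 1) -> x 0 (o4 2) = y 0 (o4 2) ->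
  x 0 (o4 3) = y 0 (o4 3) -> x = y.
Proof.
move=> h0 h1 h2 h3; apply/rowP => j; rewrite -[j]inord_val.
by case: j => [[|[|[|[|]]]] //= _].
Qed.

Lemma vec4E a b c d :
  ((vec4 a b c d 0 (o4 0) = a) * (vec4 a b c d 0 (o4 1) = b) *
   (vec4 a b c d 0 (o4 2) = c) * (vec4 a b c d 0 (o4 3) = d))%type.
Proof. by rewrite !mxE !inordK. Qed.

Lemma realvec_vec4E a b c d :
  ((realvec R (vec4 a b c d) 0 (o4 0) = a%:~R) * (realvec R (vec4 a b c d) 0 (o4 1) = b%:~R) *
   (realvec R (vec4 a b c d) 0 (o4 2) = c%:~R) * (realvec R (vec4 a b c d) 0 (o4 3) = d%:~R))%type.
Proof. by rewrite /realvec; do !split; rewrite mxE vec4E. Qed.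

Lemma pairing_vec4 u a b c d : pairing u (realvec R (vec4 a b c d)) =
  u 0 (o4 0) * a%:~R + u 0 (o4 1) * b%:~R + u 0 (o4 2) * c%:~R + u 0 (o4 3) * d%:~R.
Proof. by rewrite /pairing sum_ord4 !realvec_vec4E. Qed.

Lemma ipair_vec4 (m : 'rV[int]_4) a b c d : ipair m (vec4 a b c d) =
  m 0 (o4 0) * a + m 0 (o4 1) * b + m 0 (o4 2) * c + m 0 (o4 3) * d.
Proof. by rewrite /ipair sum_ord4 !vec4E. Qed.

End Vec4.

Definition verts1 : seq 'rV[int]_4 :=
  [:: vec4 1 0 0 0; vec4 0 1 0 0; vec4 0 0 1 0; vec4 0 0 0 1;
      vec4 (-1) (-1) (-1) (-1)].

Definition verts2 : seq 'rV[int]_4 :=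
  verts1 ++ [:: vec4 1 1 1 1; vec4 0 0 0 (-1)].

Section Polytopes.
Variable R : realType.
Implicit Types u : 'rV[R]_4.

Lemma Delta1E : Delta1 R = Conv (map (@realvec R 4) verts1).
Proof. by []. Qed.

Lemma Delta2E : Delta2 R = Conv (map (@realvec R 4) verts2).
Proof. by []. Qed.

Lemma pairing_verts1 u p : p = (fun k => pairing u (realvec R verts1`_k)) ->
  [/\ p 0%N = u 0 (o4 0), p 1%N = u 0 (o4 1), p 2 = u 0 (o4 2), p 3 = u 0 (o4 3) &
      p 4 = - (u 0 (o4 0) + u 0 (o4 1) + u 0 (o4 2) + u 0 (o4 3))].
Proof. by move=> -> /=; rewrite !pairing_vec4; split; lra. Qed.

Lemma pairing_verts2 u p : p = (fun k => pairing u (realvec R verts2`_k)) ->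
  [/\ p 0%N = u 0 (o4 0), p 1%N = u 0 (o4 1), p 2 = u 0 (o4 2), p 3 = u 0 (o4 3) &
  [/\ p 4 = - (u 0 (o4 0) + u 0 (o4 1) + u 0 (o4 2) + u 0 (o4 3)),
      p 5 = u 0 (o4 0) + u 0 (o4 1) + u 0 (o4 2) + u 0 (o4 3) & p 6 = - u 0 (o4 3)]].
Proof. by move=> -> /=; rewrite !pairing_vec4; do !split; lra. Qed.


(** * Smoothness of X(Delta1) and X(Delta2) *)

Local Ltac check_dual_basis := split=> //;
  [by move=> [|[|[|[|?]]]] [|[|[|[|?]]]] // _ _; rewrite /= ipair_vec4 !vec4E
  |by move=> [|[|[|[|[|]]]]]].

(** A proper face omits some vertex [k0], and any four of the five vertices form a lattice basis
    because the vertices sum to 0. *)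
Lemma smooth_Delta1 : toric_smooth (face_fan (Delta1 R)).
Proof.
rewrite Delta1E => sigma /face_fan_lattice[u [c [h [k0 k0L k0c] ->]]] x xP.
have face k : pairing u (realvec R verts1`_k) = c -> k != k0.
  by move=> kc; apply: contraNneq k0c => <-; apply/eqP.
suff [f [d [f4 fL df fk]]] : exists f d, [/\ size f = 4, all (fun k => k < 5)%N f,
    forall i j, (i < 4)%N -> (j < 4)%N -> ipair d`_i verts1`_(nth 0%N f j) = (i == j)%:R &
    forall k, (k < 5)%N -> k != k0 -> k \in f].
  by apply: (smooth_face_cone (f := f) (d := d)) xP => // k k5 /face; apply: fk.
case: k0 k0L {k0c face} => [|[|[|[|[|//]]]]] _.
- exists [:: 4; 1; 2; 3]%N,
    [:: vec4 (-1) 0 0 0; vec4 (-1) 1 0 0; vec4 (-1) 0 1 0; vec4 (-1) 0 0 1].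
  by check_dual_basis.
- exists [:: 0; 4; 2; 3]%N,
    [:: vec4 1 (-1) 0 0; vec4 0 (-1) 0 0; vec4 0 (-1) 1 0; vec4 0 (-1) 0 1].
  by check_dual_basis.
- exists [:: 0; 1; 4; 3]%N,
    [:: vec4 1 0 (-1) 0; vec4 0 1 (-1) 0; vec4 0 0 (-1) 0; vec4 0 0 (-1) 1].
  by check_dual_basis.
- exists [:: 0; 1; 2; 4]%N,
    [:: vec4 1 0 0 (-1); vec4 0 1 0 (-1); vec4 0 0 1 (-1); vec4 0 0 0 (-1)].
  by check_dual_basis.
- exists [:: 0; 1; 2; 3]%N,
    [:: vec4 1 0 0 0; vec4 0 1 0 0; vec4 0 0 1 0; vec4 0 0 0 1].
  by check_dual_basis.
Qed.

(* Since (1,1,1,1) + (0,0,0,-1) is the sum of the first three vertices and the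
   other primitive relations are v + (-v) = 0, a proper face omits one of the
   first three vertices and one vertex of each antipodal pair. *)
Lemma proper_face_Delta2 u c :
  (forall k, (k < 7)%N -> c <= pairing u (realvec R verts2`_k)) ->
  (exists2 k, (k < 7)%N & pairing u (realvec R verts2`_k) != c) ->
  exists l A B, [/\ (l < 3)%N, A \in [:: 4; 5]%N, B \in [:: 3; 6]%N &
    forall k, (k < 7)%N -> pairing u (realvec R verts2`_k) = c ->
      [&& k != l, k != A & k != B]].
Proof.
pose p k := pairing u (realvec R verts2`_k); move=> h hk.
have {}h k : (k < 7)%N -> c <= p k by exact: h.
have [p0 p1 p2 p3 [p4 p5 p6]] := pairing_verts2 (erefl p).
have [[[h0 h1] h2] h3] := (h 0%N isT, h 1%N isT, h 2 isT, h 3 isT).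
have [[h4 h5] h6] := (h 4 isT, h 5 isT, h 6 isT).
(* If [c >= 0], each antipodal pair forces its two values and [c] to be 0; then [p 0], [p 1], [p 2]
   are nonnegative with sum 0, so every vertex has value [c]. *)
have c0 : c < 0.
  rewrite ltNge; apply/negP => c0; case: hk => k k7 /eqP; apply.
  by move: k k7 => [|[|[|[|[|[|[|//]]]]]]] _; rewrite -/(p _); lra.
have [l l3 lc] : exists2 l, (l < 3)%N & p l <> c.
  have [e0|] := pselect (p 0%N = c); last by exists 0%N.
  have [e1|] := pselect (p 1%N = c); last by exists 1%N.
  by exists 2 => // e2; lra.
have [A A45 Ac] : exists2 A, A \in [:: 4; 5]%N & p A <> c.
  have [e4|] := pselect (p 4 = c); last by exists 4.
  by exists 5 => // e5; lra.
have [B B36 Bc] : exists2 B, B \in [:: 3; 6]%N & p B <> c.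
  have [e3|] := pselect (p 3 = c); last by exists 3.
  by exists 6 => // e6; lra.
exists l, A, B; split => // k _ kc.
by apply/and3P; split; apply/eqP => kE; [apply: lc|apply: Ac|apply: Bc]; rewrite -kE.
Qed.

Lemma smooth_Delta2 : toric_smooth (face_fan (Delta2 R)).
Proof.
rewrite Delta2E => sigma /face_fan_lattice[u [c [h hk ->]]] x xP.
have [l [A [B [l3 AP BP face]]]] := proper_face_Delta2 h hk.
suff [f [d [f4 fL df fk]]] : exists f d, [/\ size f = 4, all (fun k => k < 7)%N f,
    forall i j, (i < 4)%N -> (j < 4)%N -> ipair d`_i verts2`_(nth 0%N f j) = (i == j)%:R &
    forall k, (k < 7)%N -> [&& k != l, k != A & k != B] -> k \in f].
  by apply: (smooth_face_cone (f := f) (d := d)) xP => // k k7 /(face k k7); apply: fk.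
move: AP BP; rewrite !inE => /orP AP /orP BP.
(* [a] and [b] are the survivors of the antipodal pairs, and [a] takes the place of the omitted [l].
   The signs [s] and [t] are those of [a] along (1,1,1,1) and of [b] along the fourth basis
   vector. *)
pose a : nat := if A == 4 then 5 else 4; pose b : nat := if B == 3 then 6 else 3.
pose s : int := if A == 4 then 1 else -1; pose t : int := if B == 3 then -1 else 1.
exists (set_nth 0%N [:: 0; 1; 2; b]%N l a).
exists (nth [::] [::
  [:: vec4 s 0 0 0; vec4 (-1) 1 0 0; vec4 (-1) 0 1 0; vec4 (- t) 0 0 t];
  [:: vec4 1 (-1) 0 0; vec4 0 s 0 0; vec4 0 (-1) 1 0; vec4 0 (- t) 0 t];
  [:: vec4 1 0 (-1) 0; vec4 0 1 (-1) 0; vec4 0 0 s 0; vec4 0 0 (- t) t]] l).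
rewrite {}/a {}/b {}/s {}/t.
case: AP => /eqP->; case: BP => /eqP->; case: l l3 {face} => [|[|[|//]]] _ /=;
  (split=> //;
  [by move=> [|[|[|[|?]]]] [|[|[|[|?]]]] // _ _; rewrite /= ipair_vec4 !vec4E
  |by move=> [|[|[|[|[|[|[|]]]]]]]]).
Qed.

End Polytopes.

(** * Inclusion and reflexivity *)

Section Reflexive.
Variable R : realType.
Implicit Types u x : 'rV[R]_4.

Lemma Delta1_sub_Delta2 : Delta1 R `<=` Delta2 R.
Proof. by rewrite Delta2E; apply: Conv_lattice_prefix. Qed.

Lemma interior_Delta1 : interior (Delta1 R) 0.
Proof.
(* If all coordinates are below 1/9 in absolute value, the weight [t] chosen below to make the
   weights sum to 1 exceeds 1/9, so every [x 0 j + t] is positive. *)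
apply/nbhs_ballP; exists 9^-1; first by rewrite /= invr_gt0.
move=> x [_ x0]; rewrite Delta1E; apply/Conv_lattice_comb.
have xb j : `|x 0 j| < 9^-1 by have := x0 0 j; rewrite -ball_normE /= mxE sub0r normrN.
have [b0 b1 b2 b3] : [/\ `|x 0 (o4 0)| < 9^-1, `|x 0 (o4 1)| < 9^-1,
  `|x 0 (o4 2)| < 9^-1 & `|x 0 (o4 3)| < 9^-1] by [].
move: b0 b1 b2 b3; rewrite !ltr_norml.
move=> /andP[b0 b0'] /andP[b1 b1'] /andP[b2 b2'] /andP[b3 b3'].
pose t := (1 - (x 0 (o4 0) + x 0 (o4 1) + x 0 (o4 2) + x 0 (o4 3))) / 5.
exists (nth 0 [:: x 0 (o4 0) + t; x 0 (o4 1) + t; x 0 (o4 2) + t; x 0 (o4 3) + t; t]).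
split.
- by move=> [|[|[|[|[|k]]]]] /=; rewrite /t ?nth_nil //; lra.
- by rewrite !big_ord_recl big_ord0 /= /t; lra.
- rewrite /lattice_comb !big_ord_recl big_ord0 /=.
  by apply: row4P; rewrite !mxE !inordK //= /t; lra.
Qed.

Lemma interior_Delta2 : interior (Delta2 R) 0.
Proof. exact: interiorS Delta1_sub_Delta2 _ interior_Delta1. Qed.

(** The k-th entry pairs to 4 with the k-th vertex of [Delta1] and to -1 with the others: it is dual
    to the facet omitting that vertex. *)
Definition dual_verts1 : seq 'rV[int]_4 :=
  [:: vec4 4 (-1) (-1) (-1); vec4 (-1) 4 (-1) (-1); vec4 (-1) (-1) 4 (-1);
      vec4 (-1) (-1) (-1) 4; vec4 (-1) (-1) (-1) (-1)].

Lemma dual_polytope_lattice (L : seq 'rV[int]_4) u :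
  dual_polytope (Conv (map (@realvec R 4) L)) u <->
  forall k, (k < size L)%N -> -1 <= pairing u (realvec R L`_k).
Proof.
rewrite dual_polytope_Conv; split=> [h k kL|h i].
  have kL' : (k < size (map (@realvec R 4) L))%N by rewrite size_map.
  by have := h (Ordinal kL'); rewrite /= (nth_map 0).
have iL : (i < size L)%N by have := ltn_ord i; rewrite [X in (_ < X)%N]size_map.
by rewrite (nth_map 0) // h.
Qed.

Lemma Conv_sub_dual_lattice (L L' : seq 'rV[int]_4) :
  all (fun w => all (fun v => -1 <= ipair w v) L) L' ->
  Conv (map (@realvec R 4) L') `<=` dual_polytope (Conv (map (@realvec R 4) L)).
Proof.
move=> /allP h x Lx; apply/dual_polytope_lattice => k kL.
rewrite pairingC; move: x Lx; apply: Conv_ge => i.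
have iL : (i < size L')%N by have := ltn_ord i; rewrite [X in (_ < X)%N]size_map.
rewrite (nth_map 0) // pairingC pairing_realvec -[-1]/((-1)%:~R) ler_int.
by have /allP := h _ (mem_nth 0 iL); apply; apply: mem_nth.
Qed.

Lemma dual_Delta1 : dual_polytope (Delta1 R) = Conv (map (@realvec R 4) dual_verts1).
Proof.
rewrite Delta1E; apply/seteqP; split; last first.
  by apply: Conv_sub_dual_lattice; rewrite /= !ipair_vec4 !vec4E.
move=> u /dual_polytope_lattice h; apply/Conv_lattice_comb.
pose p k := pairing u (realvec R verts1`_k).
have {}h k : (k < 5)%N -> -1 <= p k by exact: h.
have [p0 p1 p2 p3 p4] := pairing_verts1 (erefl p).
have [[[[h0 h1] h2] h3] h4] := (h 0%N isT, h 1%N isT, h 2 isT, h 3 isT, h 4 isT).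
(* Barycentric coordinates of [u]: they sum to 1 because the [p k] sum to 0. *)
exists (nth 0 [:: (p 0%N + 1) / 5; (p 1%N + 1) / 5; (p 2 + 1) / 5; (p 3 + 1) / 5; (p 4 + 1) / 5]).
split.
- by move=> [|[|[|[|[|k]]]]] /=; rewrite ?nth_nil //; lra.
- by rewrite !big_ord_recl big_ord0 /=; lra.
- rewrite /lattice_comb !big_ord_recl big_ord0 /=.
  by apply: row4P; rewrite !mxE !inordK //=; lra.
Qed.

(** Four triples, over the corners (1,1), (1,-1), (-1,1), (-1,-1) of the square of pairs (x1 + x2 +
    x3 + x4, x4). *)
Definition dual_verts2 : seq 'rV[int]_4 :=
  [:: vec4 2 (-1) (-1) 1; vec4 (-1) 2 (-1) 1; vec4 (-1) (-1) 2 1;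
      vec4 4 (-1) (-1) (-1); vec4 (-1) 4 (-1) (-1); vec4 (-1) (-1) 4 (-1);
      vec4 0 (-1) (-1) 1; vec4 (-1) 0 (-1) 1; vec4 (-1) (-1) 0 1;
      vec4 2 (-1) (-1) (-1); vec4 (-1) 2 (-1) (-1); vec4 (-1) (-1) 2 (-1)].

(* The dual polytope is a bundle over the square of pairs (s, t) with
   s = x1 + x2 + x3 + x4 and t = x4 whose fibre over (s, t) is the triangle of
   all x with x1, x2, x3 >= -1 and x1 + x2 + x3 = s - t; the weights are the
   products of the barycentric coordinates in the fibre and in the square. *)
Lemma dual_Delta2 : dual_polytope (Delta2 R) = Conv (map (@realvec R 4) dual_verts2).
Proof.
rewrite Delta2E; apply/seteqP; split; last first.
  by apply: Conv_sub_dual_lattice; rewrite /= !ipair_vec4 !vec4E.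
move=> u /dual_polytope_lattice h; apply/Conv_lattice_comb.
pose p k := pairing u (realvec R verts2`_k).
have {}h k : (k < 7)%N -> -1 <= p k by exact: h.
have [p0 p1 p2 p3 [p4 p5 p6]] := pairing_verts2 (erefl p).
have [[[h0 h1] h2] h3] := (h 0%N isT, h 1%N isT, h 2 isT, h 3 isT).
have [[h4 h5] h6] := (h 4 isT, h 5 isT, h 6 isT).
rewrite {}p0 {}p1 {}p2 {}p3 {}p4 {}p5 {}p6 in h0 h1 h2 h3 h4 h5 h6.
set x0 := u 0 (o4 0) in h0 h1 h2 h3 h4 h5 h6.
set x1 := u 0 (o4 1) in h0 h1 h2 h3 h4 h5 h6.
set x2 := u 0 (o4 2) in h0 h1 h2 h3 h4 h5 h6.
set t := u 0 (o4 3) in h0 h1 h2 h3 h4 h5 h6.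
pose s := x0 + x1 + x2 + t.
(* [w = s - t + 3] normalises the barycentric coordinates of the fibre; it is at least 1 since
   [s >= -1] and [t <= 1]. *)
pose w := x0 + x1 + x2 + 3.
have w0 : 0 < w by rewrite /w; lra.
pose spp := (1 + s) / 2 * ((1 + t) / 2); pose spm := (1 + s) / 2 * ((1 - t) / 2).
pose smp := (1 - s) / 2 * ((1 + t) / 2); pose smm := (1 - s) / 2 * ((1 - t) / 2).
pose l0 := (x0 + 1) / w; pose l1 := (x1 + 1) / w; pose l2 := (x2 + 1) / w.
exists (nth 0 [:: spp * l0; spp * l1; spp * l2; spm * l0; spm * l1; spm * l2;
  smp * l0; smp * l1; smp * l2; smm * l0; smm * l1; smm * l2]).
have w_neq0 : w != 0 by rewrite gt_eqF.
split.
- have ge0 : [/\ 0 <= spp, 0 <= spm, 0 <= smp & 0 <= smm].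
    by split; apply: mulr_ge0; rewrite /s; lra.
  have l_ge0 : [/\ 0 <= l0, 0 <= l1 & 0 <= l2].
    by split; apply: divr_ge0; lra.
  case: ge0 l_ge0 => ? ? ? ? [? ? ?] k.
  by do 12?[case: k => [|k] /=; first exact: mulr_ge0]; rewrite nth_nil.
- rewrite !big_ord_recl big_ord0 /= /l0 /l1 /l2 /spp /spm /smp /smm /s /w.
  by field.
- rewrite /lattice_comb !big_ord_recl big_ord0 /=.
  by apply: row4P; rewrite !mxE !inordK //= -?/x0 -?/x1 -?/x2 -?/t
    /l0 /l1 /l2 /spp /spm /smp /smm /s /w; field.
Qed.

Lemma reflexive_Delta1 : reflexive_polytope (Delta1 R).
Proof.
by split; [exists verts1|exact: interior_Delta1|exists dual_verts1; exact: dual_Delta1].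
Qed.

Lemma reflexive_Delta2 : reflexive_polytope (Delta2 R).
Proof.
by split; [exists verts2|exact: interior_Delta2|exists dual_verts2; exact: dual_Delta2].
Qed.

End Reflexive.

(** * The two fans *)

Section Fans.
Variable R : realType.

Lemma cone_over_set1 (v x : 'rV[R]_4) :
  cone_over [set v] x <-> exists2 r : R, 0 <= r & x = r *: v.
Proof.
split=> [[->|[r [s [r0 -> ->]]]]|[r r0 ->]]; first by exists 0; rewrite ?scale0r.
- by exists r.
- by right; exists r, v.
Qed.

Lemma verts1_comb (a : nat -> R) :
  [/\ lattice_comb verts1 a 0 (o4 0) = a 0%N - a 4,
      lattice_comb verts1 a 0 (o4 1) = a 1%N - a 4,
      lattice_comb verts1 a 0 (o4 2) = a 2 - a 4 &
      lattice_comb verts1 a 0 (o4 3) = a 3 - a 4].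
Proof.
by rewrite /lattice_comb !big_ord_recl big_ord0 /=; split; rewrite !mxE !inordK //=; lra.
Qed.

Lemma verts2_comb (a : nat -> R) :
  [/\ lattice_comb verts2 a 0 (o4 0) = a 0%N - a 4 + a 5,
      lattice_comb verts2 a 0 (o4 1) = a 1%N - a 4 + a 5,
      lattice_comb verts2 a 0 (o4 2) = a 2 - a 4 + a 5 &
      lattice_comb verts2 a 0 (o4 3) = a 3 - a 4 + a 5 - a 6].
Proof.
by rewrite /lattice_comb !big_ord_recl big_ord0 /=; split; rewrite !mxE !inordK //=; lra.
Qed.

(* The cones over Conv(e1, e2, e3) and over the edge from (1,1,1,1) to (0,0,0,-1). *)
Definition cone_e123 : set 'rV[R]_4 :=
  face_cone (map (@realvec R 4) verts1) (realvec R (vec4 (-1) (-1) (-1) 0)) (-1).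
Definition cone_fg : set 'rV[R]_4 :=
  face_cone (map (@realvec R 4) verts2) (realvec R (vec4 (-2) (-2) (-2) 3)) (-3).

Lemma face_fan_e123 : face_fan (Delta1 R) cone_e123.
Proof.
rewrite Delta1E; apply/face_fan_lattice.
exists (realvec R (vec4 (-1) (-1) (-1) 0)), (-1); split=> //.
  by move=> [|[|[|[|[|//]]]]] _; rewrite /= pairing_realvec ipair_vec4 !vec4E; lra.
by exists 3 => //; rewrite /= pairing_realvec ipair_vec4 !vec4E; apply/eqP; lra.
Qed.

Lemma face_fan_fg : face_fan (Delta2 R) cone_fg.
Proof.
rewrite Delta2E; apply/face_fan_lattice.
(* The values at the vertices are -2, -2, -2, 3, 3, -3, -3, so the minimum is attained exactly at
   (1,1,1,1) and (0,0,0,-1). *)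
exists (realvec R (vec4 (-2) (-2) (-2) 3)), (-3); split=> //.
  by move=> [|[|[|[|[|[|[|//]]]]]]] _; rewrite /= pairing_realvec ipair_vec4 !vec4E; lra.
by exists 3 => //; rewrite /= pairing_realvec ipair_vec4 !vec4E; apply/eqP; lra.
Qed.

Lemma cone_fgP x : cone_fg x <-> exists a b : R, [/\ 0 <= a, 0 <= b &
  x = a *: realvec R (vec4 1 1 1 1) + b *: realvec R (vec4 0 0 0 (-1))].
Proof.
rewrite /cone_fg face_cone_lattice_comb; split=> [[a [a0 ac ->]]|[a [b [a0 b0 ->]]]].
  exists (a 5), (a 6); split=> //.
  have z k : (k < 5)%N -> a k = 0.
    move=> k5; apply: ac; first exact: leq_trans k5 _.
    by move: k k5 => [|[|[|[|[|//]]]]] _;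
      rewrite /= pairing_realvec ipair_vec4 !vec4E; apply/eqP; lra.
  have [c0 c1 c2 c3] := verts2_comb a; move: c0 c1 c2 c3.
  rewrite (z 0%N) // (z 1%N) // (z 2) // (z 3) // (z 4) // => c0 c1 c2 c3.
  by apply: row4P; rewrite ?c0 ?c1 ?c2 ?c3 !mxE !inordK //=; lra.
exists (nth 0 [:: 0; 0; 0; 0; 0; a; b]); split.
- by move=> [|[|[|[|[|[|[|k]]]]]]] //=; rewrite nth_nil.
- move=> [|[|[|[|[|[|[|//]]]]]]] //= _ /eqP[]; rewrite pairing_realvec ipair_vec4 !vec4E; lra.
- have [c0 c1 c2 c3] := verts2_comb (nth 0 [:: 0; 0; 0; 0; 0; a; b]).
  by apply: row4P; rewrite ?c0 ?c1 ?c2 ?c3 !mxE !inordK //=; lra.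
Qed.

(** The vector (1,1,1,0) is both e1 + e2 + e3 and (1,1,1,1) + (0,0,0,-1). On [cone_e123] the fourth
    coordinate is 0, which forces equal weights in [cone_fg]. *)
Lemma ray_intersection :
  intersection_fan (face_fan (Delta1 R)) (face_fan (Delta2 R))
    (cone_over [set realvec R (vec4 1 1 1 0)]).
Proof.
exists cone_e123, cone_fg; split; [exact: face_fan_e123|exact: face_fan_fg|].
apply/seteqP; split=> x.
  move=> /cone_over_set1[r r0 ->]; split.
    apply/face_cone_lattice_comb; exists (nth 0 [:: r; r; r]); split.
    - by move=> [|[|[|k]]] //=; rewrite nth_nil.
    - by move=> [|[|[|[|[|//]]]]] //= _ /eqP[]; rewrite pairing_realvec ipair_vec4 !vec4E; lra.
    - have [c0 c1 c2 c3] := verts1_comb (nth 0 [:: r; r; r]).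
      by apply: row4P; rewrite ?c0 ?c1 ?c2 ?c3 mxE realvec_vec4E /=; lra.
  apply/cone_fgP; exists r, r; split=> //.
  by apply: row4P; rewrite !mxE !inordK //=; lra.
move=> [/face_cone_lattice_comb[a [a0 ac xa]] /cone_fgP[b [c [b0 c0 xbc]]]].
apply/cone_over_set1; exists b => //.
have a34 : a 3 = 0 /\ a 4 = 0.
  by split; apply: ac => //=; rewrite pairing_realvec ipair_vec4 !vec4E; apply/eqP; lra.
have [_ _ _ e3] := verts1_comb a; move: e3; case: a34 => -> ->; rewrite -xa xbc.
rewrite !mxE !inordK //= => e3.
by apply: row4P; rewrite !mxE !inordK //=; lra.
Qed.

(** Any vertex with nonzero weight in an expression of [v] generates part of the cone, hence lies on
    the ray. *)
Lemma ray_vertex (L : seq 'rV[int]_4) (v : 'rV[R]_4) :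
  v != 0 -> face_fan (Conv (map (@realvec R 4) L)) (cone_over [set v]) ->
  exists2 k, (k < size L)%N & exists r : R, realvec R L`_k = r *: v.
Proof.
move=> v0 /face_fan_lattice[u [c [h _ E]]].
have : cone_over [set v] v by apply/cone_over_set1; exists 1; rewrite ?scale1r.
rewrite E => /face_cone_lattice_comb[a [a0 ac va]].
have [k kL ak] : exists2 k, (k < size L)%N & a k != 0.
  apply: contrapT => hn; move/eqP: v0; apply; rewrite va; apply: big1 => i _.
  have [->|ai] := eqVneq (a i) 0; first exact: scale0r.
  by case: hn; exists i.
exists k => //; have kc : pairing u (realvec R L`_k) = c.
  by apply: contraNeq ak => kc; rewrite ac.
have kL' : (k < size (map (@realvec R 4) L))%N by rewrite size_map.
have := @face_cone_vertex R 4 (map (@realvec R 4) L) u c (Ordinal kL').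
rewrite -E /= (nth_map 0) // => /(_ kc) /cone_over_set1[r _ rE].
by exists r.
Qed.

Lemma vec1110_neq0 : realvec R (vec4 1 1 1 0) != 0.
Proof.
apply/eqP => /rowP/(_ (o4 0)); rewrite realvec_vec4E mxE => /eqP.
by rewrite oner_eq0.
Qed.

Lemma ray_notin_fan1 : ~ face_fan (Delta1 R) (cone_over [set realvec R (vec4 1 1 1 0)]).
Proof.
rewrite Delta1E => /(ray_vertex vec1110_neq0)[k k5 [r kr]].
have {}kr j : realvec R verts1`_k 0 j = r * realvec R (vec4 1 1 1 0) 0 j.
  by rewrite kr mxE.
move: (kr (o4 0)) (kr (o4 1)) (kr (o4 2)) (kr (o4 3)).
by move: k k5 {kr} => [|[|[|[|[|//]]]]] _ /=; rewrite !realvec_vec4E; lra.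
Qed.

Lemma ray_notin_fan2 : ~ face_fan (Delta2 R) (cone_over [set realvec R (vec4 1 1 1 0)]).
Proof.
rewrite Delta2E => /(ray_vertex vec1110_neq0)[k k7 [r kr]].
have {}kr j : realvec R verts2`_k 0 j = r * realvec R (vec4 1 1 1 0) 0 j.
  by rewrite kr mxE.
move: (kr (o4 0)) (kr (o4 1)) (kr (o4 2)) (kr (o4 3)).
by move: k k7 {kr} => [|[|[|[|[|[|[|//]]]]]]] _ /=; rewrite !realvec_vec4E; lra.
Qed.

Lemma notin_Delta2 : ~ Delta2 R (realvec R (vec4 1 1 1 0)).
Proof.
(* This functional is at least -1 on [Delta2] but takes the value -2 at (1,1,1,0). *)
have : dual_polytope (Delta2 R) (realvec R (vec4 (-1) (-1) 0 1)).
  rewrite Delta2E; apply/dual_polytope_lattice.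
  by move=> [|[|[|[|[|[|[|//]]]]]]] _; rewrite /= pairing_realvec ipair_vec4 !vec4E; lra.
by move=> h /h; rewrite pairing_realvec ipair_vec4 !vec4E; lra.
Qed.

Lemma notin_Delta1 : ~ Delta1 R (realvec R (vec4 1 1 1 0)).
Proof. by move=> /Delta1_sub_Delta2; apply: notin_Delta2. Qed.

(* hchar i k is the character x_i / x_k of the torus of X(Delta1) = P^4, in
   the homogeneous coordinates x_j attached to the vertices of Delta1. *)
Definition hchar (i k : nat) : 'rV[int]_4 :=
  \row_(j < 4) ((i == j)%:R - (k == j)%:R).

Lemma hchar_verts1 i k l : (i < 5)%N -> (k < 5)%N -> (l < 5)%N ->
  ipair (hchar i k) verts1`_l = (i == l)%:R - (k == l)%:R.
Proof.
move=> i5 k5 l5; move: l5; case: l => [|[|[|[|[|//]]]]] _; rewrite /= ipair_vec4 !mxE !inordK //;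
by move: i i5 k k5 => [|[|[|[|[|//]]]]] _ [|[|[|[|[|//]]]]].
Qed.

Lemma hcharD i j k : hchar i j + hchar j k = hchar i k.
Proof. by apply/rowP => l; rewrite !mxE addrA subrK. Qed.

Lemma hcharkk k : hchar k k = 0.
Proof. by apply/rowP => l; rewrite !mxE subrr. Qed.

(** That the cone avoids the vertex [k] is expressed through regularity of all x_i / x_k on its
    chart, the form used for P^4. *)
Definition omits (C : set 'rV[R]_4) (k : nat) : Prop :=
  (k < 5)%N /\ forall i, (i < 5)%N -> dual_semigroup C (hchar i k).

Lemma face_fan1_omits C : face_fan (Delta1 R) C -> exists k, omits C k.
Proof.
rewrite Delta1E => /face_fan_lattice[u [c [h [k k5 kc] ->]]].
exists k; split=> // i i5; apply/dual_semigroup_face_cone => l l5 lc.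
rewrite hchar_verts1 //; have [kl|_] := eqVneq k l; last by rewrite subr0 ler0n.
by rewrite kl lc eqxx in kc.
Qed.

Definition ray_f : 'rV[int]_4 := vec4 1 1 1 1.
Definition ray_g : 'rV[int]_4 := vec4 0 0 0 (-1).

Lemma cone_fg_comb (a b : nat) : cone_fg (realvec R (ray_f *+ a + ray_g *+ b)).
Proof.
apply/cone_fgP; exists a%:R, b%:R; split; rewrite ?ler0n //.
by apply/rowP => j; rewrite !scaler_nat !(mxE, mulmxnE) rmorphD !rmorphMn.
Qed.

(** For [k < 4] take the direction (2,2,2,1), on which x_4 / x_k has order minus the k-th entry. For
    [k = 4] take (1,1,1,-1), on which x_3 / x_4 has order -1. *)
Lemma hchar_negative k : (k < 5)%N -> exists i a b,
  [/\ (i < 5)%N, (0 < a)%N, (0 < b)%N & ipair (hchar i k) (ray_f *+ a + ray_g *+ b) < 0].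
Proof.
case: k => [|[|[|[|[|//]]]]] _.
1-4: exists 4, 2, 1%N; split=> //; rewrite /ipair sum_ord4 !mxE !inordK //; lia.
exists 3, 1%N, 2; split=> //; rewrite /ipair sum_ord4 !mxE !inordK //; lia.
Qed.

Lemma not_refines : ~ refines (face_fan (Delta2 R)) (face_fan (Delta1 R)).
Proof.
move=> /(_ _ face_fan_fg)[C /face_fan1_omits[k [k5 kC]] sC].
have [i [a [b [i5 _ _]]]] := hchar_negative k5.
apply/negP; rewrite -leNgt -(ler0z R) -pairing_realvec.
by apply: (kC i i5); apply: sC; apply: cone_fg_comb.
Qed.

End Fans.
Arguments cone_fg R : clear implicits.

(** * Toric morphisms along one-parameter curves *)

Section Polynomials.
Variable F : numFieldType.

(** In characteristic 0 the naturals below [size p] are too many distinct roots for a nonzero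
    [p]. *)
Lemma poly_zero_everywhere (p : {poly F}) : (forall x, p.[x] = 0) -> p = 0.
Proof.
move=> p0; apply/eqP; apply: contraT => pn0.
have := @max_poly_roots _ p [seq i%:R | i <- iota 0 (size p)] pn0.
rewrite size_map size_iota ltnn; apply.
  by apply/allP => x _; apply/rootP.
by rewrite map_inj_uniq ?iota_uniq //; apply: mulrIn; rewrite oner_eq0.
Qed.

(** [P / Q] would have a pole of order [N] at 0 although [Q] is nonzero there. Multiplying by
    ['X * U * Q] extends the identity to all points, and these factors are nonzero polynomials. *)
Lemma poly_pole_contradiction (P Q U : {poly F}) N :
  U.[0] != 0 -> Q.[0] != 0 -> (0 < N)%N ->
  (forall x, x != 0 -> U.[x] != 0 -> Q.[x] != 0 -> Q.[x] = x ^+ N * P.[x]) -> False.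
Proof.
move=> U0 Q0 N0 h.
have nz (p : {poly F}) : p.[0] != 0 -> p != 0.
  by apply: contraNneq => ->; rewrite horner0.
have : 'X * U * Q * (Q - 'X^N * P) = 0.
  apply: poly_zero_everywhere => x; rewrite !hornerM hornerX hornerD hornerN hornerM hornerXn.
  have [->|x0] := eqVneq x 0; first by rewrite !mul0r.
  have [->|Ux] := eqVneq U.[x] 0; first by rewrite mulr0 !mul0r.
  have [->|Qx] := eqVneq Q.[x] 0; first by rewrite mulr0 !mul0r.
  by rewrite -(h x x0 Ux Qx) subrr mulr0.
move/eqP; rewrite !mulf_eq0 polyX_eq0 (negPf (nz _ U0)) (negPf (nz _ Q0)) /= subr_eq0.
move=> /eqP QE; move/eqP: Q0; apply.
by rewrite QE hornerM hornerXn expr0n eqn0Ngt N0 mul0r.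
Qed.

End Polynomials.

(** * Curves in the torus and their limits *)

Section Curves.
Variables (R : realType) (n : nat).
Local Open Scope complex_scope.
Implicit Types (sigma : set 'rV[R]_n) (w m : 'rV[int]_n).

Definition torus_curve w (l : R[i]) m : R[i] := l ^ ipair m w.

(** Enforces the convention that points of a chart are extended by 0. *)
Definition chart_restrict sigma (x : 'rV[int]_n -> R[i]) m : R[i] :=
  if `[< dual_semigroup sigma m >] then x m else 0.

(* The limit at 0 of [torus_curve w] in the chart of a cone containing w. *)
Definition curve_limit w m : R[i] := (ipair m w == 0)%:R.

Lemma torus_curveD w l m m' : l != 0 ->
  torus_curve w l (m + m') = torus_curve w l m * torus_curve w l m'.
Proof. by move=> l0; rewrite /torus_curve ipairDl expfzDr. Qed.

Lemma torus_curve0 w l : torus_curve w l 0 = 1.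
Proof. by rewrite /torus_curve ipair0l. Qed.

Lemma affine_torus_curve sigma w l : l != 0 ->
  affine_point sigma (chart_restrict sigma (torus_curve w l)).
Proof.
move=> l0; split=> [|m m' Sm Sm'|m Sm].
- by rewrite /chart_restrict asboolT ?torus_curve0 //; apply: dual_semigroup0.
- by rewrite /chart_restrict !asboolT ?torus_curveD //; apply: dual_semigroupD.
- by rewrite /chart_restrict asboolF.
Qed.

Lemma dual_semigroup_sub0 sigma m : sigma `<=` [set 0] -> dual_semigroup sigma m.
Proof. by move=> s0 x /s0 ->; rewrite /pairing big1 // => j _; rewrite [X in _ * X]mxE mulr0. Qed.

Lemma chart_restrict_sub0 sigma x : sigma `<=` [set 0] -> chart_restrict sigma x = x.
Proof.
by move=> s0; apply/funext => m; rewrite /chart_restrict asboolT //; apply: dual_semigroup_sub0.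
Qed.

Lemma ipair_ge0 sigma w m : sigma (realvec R w) -> dual_semigroup sigma m -> 0 <= ipair m w.
Proof. by move=> sw /(_ _ sw); rewrite pairing_realvec ler0z. Qed.

Lemma affine_curve_limit sigma w : sigma (realvec R w) ->
  affine_point sigma (chart_restrict sigma (curve_limit w)).
Proof.
move=> sw; split=> [|m m' Sm Sm'|m Sm].
- by rewrite /chart_restrict asboolT /curve_limit ?ipair0l ?eqxx //; apply: dual_semigroup0.
- rewrite /chart_restrict !asboolT //; last exact: dual_semigroupD.
  rewrite /curve_limit ipairDl paddr_eq0 ?(ipair_ge0 sw) //.
  by rewrite -natrM mulnb.
- by rewrite /chart_restrict asboolF.
Qed.

(** Characters in the dual semigroup pair nonnegatively with [w], so along the curve they are
    monomials in [l]; at 0 only those of exponent 0 survive. *)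
Lemma coordinate_function_curve sigma w g :
  sigma (realvec R w) -> coordinate_function sigma g ->
  exists2 P : {poly R[i]}, P.[0] = g (chart_restrict sigma (curve_limit w)) &
    forall l, P.[l] = g (chart_restrict sigma (torus_curve w l)).
Proof.
move=> sw [s [sP gE]]; exists (\sum_(a <- s) a.1 *: 'X^(`|ipair a.2 w|%N)) => [|l].
  rewrite horner_sum gE; apply: eq_big_seq => a /sP Sa.
  by rewrite hornerZ hornerXn /chart_restrict asboolT // /curve_limit expr0n absz_eq0.
rewrite horner_sum gE; apply: eq_big_seq => a /sP Sa.
rewrite hornerZ hornerXn /chart_restrict asboolT // /torus_curve.
by rewrite -{2}(gez0_abs (ipair_ge0 sw Sa)) -exprnP.
Qed.

Variable Sigma : set (set 'rV[R]_n).

Lemma toric_class_eq (p q : chart_point Sigma) :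
  toric_class p = toric_class q -> clos_refl_sym_trans _ (@glued R n Sigma) p q.
Proof.
move=> /(congr1 (@proj1_sig _ _)) /= E.
have : [set q' | clos_refl_sym_trans _ (@glued R n Sigma) q q'] q by exact: rst_refl.
by rewrite -E.
Qed.

Lemma glued_toric_class (p q : chart_point Sigma) :
  glued p q -> toric_class p = toric_class q.
Proof.
move=> pq; apply: eq_exist; apply/seteqP; split=> r h /=.
  by apply: rst_trans h; apply: rst_sym; apply: rst_step.
by apply: rst_trans h; apply: rst_step.
Qed.

Lemma toric_classP (P : toric_point Sigma) : exists p, P = toric_class p.
Proof. by case: P => A [p E]; exists p; apply: eq_exist. Qed.

Lemma glued_torus_curve w l (p q : chart_point Sigma) : l != 0 ->
  chart_pt p = chart_restrict (chart_cone p) (torus_curve w l) ->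
  chart_cone q = [set 0] -> chart_pt q = torus_curve w l -> glued p q.
Proof.
move=> l0 pE qc qE; exists (torus_curve w l); split=> [|m Sm|m Sm].
- have s0 : chart_cone p `&` chart_cone q `<=` [set 0] by rewrite qc; apply: subIsetr.
  by rewrite -(chart_restrict_sub0 (torus_curve w l) s0); apply: affine_torus_curve.
- by rewrite pE /chart_restrict asboolT.
- by rewrite qE.
Qed.

End Curves.

(** * Homogeneous coordinates on X(Delta1) *)

Section ProjectiveSpace.
Variable R : realType.
Local Open Scope complex_scope.
Local Notation Sigma1 := (face_fan (Delta1 R)).
Implicit Types p q : chart_point Sigma1.

(** The index depends on the cone alone, so all points of a chart share one normalisation. By
    [omittedP] the default 0 is never taken on cones of the fan for lack of a valid index. *)
Definition omitted (C : set 'rV[R]_4) : nat := xget 0%N [set k | omits C k].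

Lemma omittedP p : omits (chart_cone p) (omitted (chart_cone p)).
Proof.
have [k kP] := face_fan1_omits (chart_coneP p).
exact: (xgetPex 0%N (ex_intro _ k kP)).
Qed.

(* Homogeneous coordinates on X(Delta1) = P^4, normalised at an index whose
   vertex is not in the cone of the chart. *)
Definition hcoord p i : R[i] := chart_pt p (hchar i (omitted (chart_cone p))).

Lemma hcoord_omitted p : hcoord p (omitted (chart_cone p)) = 1.
Proof. by rewrite /hcoord hcharkk; case: (chart_ptP p). Qed.

Definition proportional p q :=
  exists2 u : R[i], u != 0 & forall i, (i < 5)%N -> hcoord q i = u * hcoord p i.

(** The factor is the value of x_k / x_l at the common point [z]; it is a unit because x_l / x_k is
    also regular on the overlap. *)
Lemma glued_proportional p q : glued p q -> proportional p q.
Proof.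
move=> [z [[z1 zD _] zp zq]].
have [k5 kp] := omittedP p; have [l5 lq] := omittedP q.
set k := omitted _ in k5 kp; set l := omitted _ in l5 lq.
have Sp m : dual_semigroup (chart_cone p) m ->
    dual_semigroup (chart_cone p `&` chart_cone q) m.
  by apply: dual_semigroupS; apply: subIsetl.
have Sq m : dual_semigroup (chart_cone q) m ->
    dual_semigroup (chart_cone p `&` chart_cone q) m.
  by apply: dual_semigroupS; apply: subIsetr.
exists (z (hchar k l)).
  have := zD _ _ (Sq _ (lq k k5)) (Sp _ (kp l l5)).
  rewrite hcharD hcharkk z1 => /esym/eqP; apply: contraTneq => ->.
  by rewrite mul0r eq_sym oner_eq0.
move=> i i5; rewrite /hcoord -/k -/l zp ?zq; [|exact: lq|exact: kp].
by rewrite mulrC -zD ?hcharD; [|exact/Sp/kp|exact/Sq/lq].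
Qed.

Lemma toric_class_proportional p q : toric_class p = toric_class q -> proportional p q.
Proof.
move=> /toric_class_eq; elim=> {p q} [p q|p|p q _ [u u0 h]|p q r _ [u u0 h] _ [v v0 h']].
- exact: glued_proportional.
- by exists 1 => [|i _]; rewrite ?oner_eq0 ?mul1r.
- by exists u^-1 => [|i i5]; rewrite ?invr_eq0 // h // mulKf.
- by exists (v * u) => [|i i5]; rewrite ?mulf_neq0 // h' // h // mulrA.
Qed.

Definition toric_repr (P : toric_point Sigma1) : chart_point Sigma1 :=
  projT1 (cid (toric_classP P)).

Lemma toric_reprK P : toric_class (toric_repr P) = P.
Proof. by rewrite /toric_repr; case: cid. Qed.

(** Proportionality makes this set, and the ratio below, independent of the representative. *)
Definition hopen k : set (toric_point Sigma1) :=
  [set P | hcoord (toric_repr P) k != 0].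

Definition hratio i k (P : toric_point Sigma1) : R[i] :=
  hcoord (toric_repr P) i / hcoord (toric_repr P) k.

Lemma hopenE k p : (k < 5)%N -> hopen k (toric_class p) <-> hcoord p k != 0.
Proof.
move=> k5; have [u u0 h] := toric_class_proportional (toric_reprK (toric_class p)).
by rewrite /hopen /= h // mulf_eq0 negb_or u0.
Qed.

Lemma hratioE i k p : (i < 5)%N -> (k < 5)%N ->
  hratio i k (toric_class p) = hcoord p i / hcoord p k.
Proof.
move=> i5 k5; have [u u0 h] := toric_class_proportional (toric_reprK (toric_class p)).
by rewrite /hratio !h // -mulf_div divff // mul1r.
Qed.

Lemma hcoord_coordinate_function p i : (i < 5)%N ->
  exists2 g, coordinate_function (chart_cone p) g &
    forall q, chart_cone q = chart_cone p -> g (chart_pt q) = hcoord q i.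
Proof.
move=> i5; exists (fun x => x (hchar i (omitted (chart_cone p)))).
  exists [:: (1, hchar i (omitted (chart_cone p)))]; split=> [a|x].
    by rewrite inE => /eqP ->; have [_] := omittedP p; apply.
  by rewrite big_seq1 mul1r.
by move=> q qp; rewrite /hcoord qp.
Qed.

Lemma toric_open_hopen k : (k < 5)%N -> toric_open (hopen k).
Proof.
move=> k5 p /(hopenE _ k5) pk; have [g gP gE] := hcoord_coordinate_function p k5.
exists g; split=> [//||q qp]; rewrite gE //.
by move/(hopenE _ k5).
Qed.

Lemma toric_regular_hratio i k : (i < 5)%N -> (k < 5)%N ->
  toric_regular (hopen k) (hratio i k).
Proof.
move=> i5 k5 p /(hopenE _ k5) pk.
have [g gP gE] := hcoord_coordinate_function p i5.
have [h hP hE] := hcoord_coordinate_function p k5.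
exists g, h; split=> [//|//||q qp _ _]; first by rewrite hE.
by rewrite hratioE // gE // hE.
Qed.

End ProjectiveSpace.

(** * Non-existence of the toric morphism *)

Section NoMorphism.
Variable R : realType.
Local Open Scope complex_scope.
Local Notation Sigma1 := (face_fan (Delta1 R)).
Local Notation Sigma2 := (face_fan (Delta2 R)).

Lemma face_fan_zero (L : seq 'rV[int]_4) : (0 < size L)%N ->
  face_fan (Conv (map (@realvec R 4) L)) [set 0].
Proof.
have p0 (x : 'rV[R]_4) : pairing 0 x = 0.
  by rewrite /pairing big1 // => j _; rewrite mxE mul0r.
(* The zero functional with bound -1 cuts out the empty face. *)
move=> L0; apply/face_fan_lattice; exists 0, (-1); split.
- by move=> k _; rewrite p0; lra.
- by exists 0%N => //; rewrite p0; apply/eqP; lra.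
apply/seteqP; split=> x.
  move=> ->; apply/face_cone_lattice_comb; exists (fun=> 0); split=> //.
  by rewrite /lattice_comb big1 // => k _; rewrite scale0r.
move=> /face_cone_lattice_comb[a [_ ac ->]]; apply: big1 => k _.
by rewrite ac ?scale0r // p0; apply/eqP; lra.
Qed.

(** On the dual semigroup both pairings are nonnegative, so a positive combination of them vanishes
    exactly when both do. *)
Lemma curve_limit_fg (a b : nat) : (0 < a)%N -> (0 < b)%N ->
  chart_restrict (cone_fg R) (curve_limit R (ray_f *+ a + ray_g *+ b)) =
  chart_restrict (cone_fg R) (curve_limit R (ray_f + ray_g)).
Proof.
move=> a0 b0; apply/funext => m; rewrite /chart_restrict; case: asboolP => // Sm.
have f0 : 0 <= ipair m ray_f.
  by have := ipair_ge0 (cone_fg_comb R 1 0) Sm; rewrite mulr1n mulr0n addr0.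
have g0 : 0 <= ipair m ray_g.
  by have := ipair_ge0 (cone_fg_comb R 0 1) Sm; rewrite mulr1n mulr0n add0r.
rewrite /curve_limit !ipairDr !ipairMnr; congr (nat_of_bool _)%:R.
by rewrite !paddr_eq0 ?mulrn_wge0 // !mulrn_eq0 !eqn0Ngt a0 b0.
Qed.

Lemma no_toric_morphism : ~ induces_toric_morphism Sigma2 Sigma1 (1%:M : 'M[int]_4).
Proof.
move=> [phi [phiM phiT]].
have limP : affine_point (cone_fg R) (chart_restrict (cone_fg R) (curve_limit R (ray_f + ray_g))).
  by apply: affine_curve_limit; apply: (cone_fg_comb R 1 1).
pose p0 := ChartPoint (face_fan_fg R) limP.
have [q0 q0E] := toric_classP (phi (toric_class p0)).
set k := omitted (chart_cone q0).
have k5 : (k < 5)%N by have [] := omittedP q0.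
have [i [a [b [i5 a0 b0 neg]]]] := hchar_negative k5.
set w := _ + _ in neg.
have sw : cone_fg R (realvec R w) by apply: cone_fg_comb.
have p0E : chart_pt p0 = chart_restrict (cone_fg R) (curve_limit R w).
  by rewrite /= curve_limit_fg.
have [phi_open phi_reg] := phiM _ (toric_open_hopen k5).
have Vp0 : (phi @^-1` hopen k) (toric_class p0).
  by rewrite /preimage /= q0E; apply/hopenE => //; rewrite hcoord_omitted oner_eq0.
(* [u] cuts out a neighbourhood of the distinguished point that [phi] maps into [hopen k]; on a
   smaller one the pullback of x_i / x_k is [g / h]. *)
have [u [uP u0 uV]] := phi_open p0 Vp0.
have [g [h [gP hP h0 ghE]]] := phi_reg _ (toric_regular_hratio i5 k5) p0 Vp0.
have [U U0 UE] := coordinate_function_curve sw uP.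
have [P _ PE] := coordinate_function_curve sw gP.
have [Q Q0 QE] := coordinate_function_curve sw hP.
rewrite p0E in u0 h0.
apply: (@poly_pole_contradiction _ P Q U `|ipair (hchar i k) w|%N).
- by rewrite U0.
- by rewrite Q0.
- by rewrite absz_gt0 ltr0_neq0.
move=> l l0 Ul Ql.
pose ql := ChartPoint (face_fan_fg R) (affine_torus_curve (cone_fg R) w l0).
have tP : affine_point [set (0 : 'rV[R]_4)] (torus_curve w l).
  rewrite -(chart_restrict_sub0 (torus_curve w l) (@subset_refl _ [set (0 : 'rV[R]_4)])).
  exact: affine_torus_curve.
(* The same torus point in both varieties; [phiT] sends one to the other. *)
pose t2 := @ChartPoint R 4 Sigma2 _ (@face_fan_zero verts2 isT) _ tP.
pose t1 := @ChartPoint R 4 Sigma1 _ (@face_fan_zero verts1 isT) _ tP.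
have phil : phi (toric_class ql) = toric_class t1.
  rewrite (glued_toric_class (@glued_torus_curve _ _ _ w l ql t2 l0 erefl erefl erefl)).
  by apply: phiT => // m; rewrite trmx1 mulmx1.
have Vl : hopen k (phi (toric_class ql)) by apply: uV => //; rewrite /= -UE.
have := ghE ql erefl Vl; rewrite /= -QE => /(_ Ql).
rewrite phil hratioE // /hcoord /= -PE.
set j := omitted _.
(* The normalising index [j] of the zero cone cancels in the ratio of coordinates. *)
have jE : torus_curve w l (hchar i j) = torus_curve w l (hchar i k) * torus_curve w l (hchar k j).
  by rewrite -torus_curveD // hcharD.
have kj0 : torus_curve w l (hchar k j) != 0 by apply: expfz_neq0.
rewrite jE mulfK // => E.
rewrite -(divfK Ql P.[l]) -E mulrA /torus_curve.
have -> : l ^+ `|ipair (hchar i k) w|%N * l ^ ipair (hchar i k) w = 1.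
  by rewrite exprnP -expfzDr // ltz0_abs // addNr.
by rewrite mul1r.
Qed.

End NoMorphism.

Unset Implicit Arguments.

Theorem mainTheorem3 (R : realType) :
  let D1 := Delta1 R in
  let D2 := Delta2 R in
  let v : 'rV[R]_4 := realvec R (vec4 1 1 1 0) in
  let ray := cone_over [set v] in
  [/\ D1 `<=` D2, reflexive_polytope D1 & reflexive_polytope D2] /\
  (toric_smooth (face_fan D1) /\ toric_smooth (face_fan D2)) /\
  [/\ intersection_fan (face_fan D1) (face_fan D2) ray,
      ~ face_fan D1 ray,
      ~ face_fan D2 ray,
      ~ D1 v &
      ~ D2 v] /\
  ~ refines (face_fan D2) (face_fan D1) /\
  ~ induces_toric_morphism (face_fan D2) (face_fan D1) (1%:M : 'M[int]_4).
Proof.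
split; first by split; [exact: Delta1_sub_Delta2|exact: reflexive_Delta1|exact: reflexive_Delta2].
split; first by split; [exact: smooth_Delta1|exact: smooth_Delta2].
split; last by split; [exact: not_refines|exact: no_toric_morphism].
split; [exact: ray_intersection|exact: ray_notin_fan1|exact: ray_notin_fan2
       |exact: notin_Delta1|exact: notin_Delta2].
Qed.
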